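(* Let $$\Gamma_d=\max_{\varnothing\ne u\subseteq\{1,\dots,d\}}\ \sup_{\boldsymbol{k}\in\mathbb{N}_0^u}\ \sup_{n\in\mathbb{N}}G_{u,\boldsymbol{k}}(n),$$ where $G_{u,\boldsymbol{k}}(n)$ are the gain coefficients of the Halton points. Then $\Gamma_d=O(\log d)$ as $d\to\infty$.
   Context: $\mathbb{N}=\{1,2,\dots\}$, $\mathbb{N}_0=\mathbb{N}\cup\{0\}$. For $j\in\mathbb{N}$, $b_j$ is the $j$-th prime ($b_1=2,b_2=3,b_3=5,\dots$). For $i\in\mathbb{N}_0$ write $i=\sum_{\ell\ge1}a_{ij\ell}b_j^{\ell-1}$ with base-$b_j$ digits $a_{ij\ell}\in\{0,\dots,b_j-1\}$; the (unscrambled) Halton points are $\boldsymbol{a}_i=(a_{i1},\dots,a_{id})\in[0,1)^d$, $i\in\mathbb{N}_0$, with $a_{ij}=\sum_{\ell\ge1}a_{ij\ell}b_j^{-\ell}$. For $u\subseteq\{1,\dots,d\}$, $\mathbb{N}_0^u$ is the set of vectors $\boldsymbol{k}=(k_j)_{j\in u}$ of nonnegative integers indexed by $u$. For non-empty $u\subseteq\{1,\dots,d\}$, $\boldsymbol{k}\in\mathbb{N}_0^u$ and $n\in\mathbb{N}$, the gain coefficient is $$G_{u,\boldsymbol{k}}(n)=\frac1n\prod_{j\in u}\frac1{b_j-1}\ \sum_{i=0}^{n-1}\sum_{i'=0}^{n-1}\prod_{j\in u}\Bigl(b_j\mathbf{1}\{\lfloor b_j^{k_j+1}a_{ij}\rfloor=\lfloor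 b_j^{k_j+1}a_{i'j}\rfloor\}-\mathbf{1}\{\lfloor b_j^{k_j}a_{ij}\rfloor=\lfloor b_j^{k_j}a_{i'j}\rfloor\}\Bigr),$$ where $\mathbf{1}\{A\}$ is $1$ if $A$ holds and $0$ otherwise. *)

(* Defs.v *)
From mathcomp Require Import all_boot all_order all_algebra.
From mathcomp Require Import all_classical all_reals all_analysis.

Set Implicit Arguments.
Unset Strict Implicit.
Unset Printing Implicit Defensive.

Import Order.TTheory GRing.Theory Num.Theory.
Import numFieldNormedType.Exports.

Local Open Scope classical_set_scope.
Local Open Scope ring_scope.

Lemma ex_prime_above (m : nat) : exists p, prime p && (m < p)%N.
Proof. by have [p mp pp] := prime_above m; exists p; rewrite pp mp. Qed.

(* Primes are numbered from 0 (2, 3, 5, ...), so that the index set {1, ..., d}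
   is represented by 'I_d, with j : 'I_d standing for the index j + 1. *)
Fixpoint nth_prime (j : nat) : nat :=
  if j is j'.+1 then ex_minn (ex_prime_above (nth_prime j')) else 2.

(* Digits are numbered from l = 1, the units digit; l = 0 is never used. *)
Definition digit (b i l : nat) : nat := ((i %/ b ^ l.-1) %% b)%N.

Definition halton (R : realType) (i j : nat) : R :=
  limn (fun N => \sum_(1 <= l < N)
    (digit (nth_prime j) i l)%:R / (nth_prime j)%:R ^+ l : R).

(* Whether x and y lie in the same interval [c b^-m, (c + 1) b^-m), c integer. *)
Definition same_cell (R : realType) (b m : nat) (x y : R) : bool :=
  Num.floor (b%:R ^+ m * x) == Num.floor (b%:R ^+ m * y).

Definition gain (R : realType) (d : nat) (u : {set 'I_d})
    (k : {j : 'I_d | j \in u} -> nat) (n : nat) : R :=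
  n%:R^-1 * (\prod_(j : {j : 'I_d | j \in u}) ((nth_prime (val j))%:R - 1)^-1) *
  \sum_(i < n) \sum_(i' < n) \prod_(j : {j : 'I_d | j \in u})
    let b := nth_prime (val j) in
    (b%:R * (same_cell b (k j).+1 (halton R i (val j)) (halton R i' (val j)))%:R
     - (same_cell b (k j) (halton R i (val j)) (halton R i' (val j)))%:R).

(* The suprema are taken in the extended reals, where they always exist: an
   unbounded family gives +oo. The maximum is over a non-empty range of u
   as soon as d > 0. *)
Definition max_gain (R : realType) (d : nat) : \bar R :=
  \big[maxe/-oo%E]_(u : {set 'I_d} | u != finset.set0)
    ereal_sup [set ereal_sup [set (gain R k n)%:E | n in [set n | (0 < n)%N]]
              | k in [set: {j : 'I_d | j \in u} -> nat]].

(* Main.v *)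
Require Import Defs.
From mathcomp Require Import all_boot all_order all_algebra.
From mathcomp Require Import all_classical all_reals all_analysis.
From mathcomp Require Import zify ring lra.
Import Order.TTheory GRing.Theory Num.Theory.
Import numFieldNormedType.Exports.
Local Open Scope classical_set_scope.
Local Open Scope ring_scope.

Set Implicit Arguments.
Unset Strict Implicit.
Unset Printing Implicit Defensive.

(** The kernel prod_j (b_j 1_(k_j+1) - 1_(k_j)), where 1_m(i, i') indicates that
    i and i' are congruent mod b_j^m, is positive semidefinite, and so is each
    1_m. Expanding b_j 1_(k_j+1) = C_j + D_j with D_j = 1_(k_j) and discarding the
    mixed terms bounds the sum of prod_j C_j by that of prod_j b_j 1_(k_j+1) - prod_j D_j,
    which counts congruent pairs and is at most n prod_j b_j. Hence each gain
    coefficient lies between 0 and the product of b / (b - 1) over the first d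
    primes, and this product is O(log d) by Mertens' estimate
    sum_(p <= n) 1 / p <= log log n + O(1). The latter follows by Abel summation from
    sum_(p <= n) log p / p <= log n + log 4, which is read off
    prod_(p <= n) p^(n / p) | n! and prod_(p <= n) p <= 4^n. *)

(** * Chebyshev-type bounds: the primorial and prime powers in factorials *)

Lemma pairwise_coprime_prime_pow (e : nat -> nat) (r : seq nat) :
  all prime r -> uniq r -> pairwise coprime [seq p ^ e p | p <- r]%N.
Proof.
move=> rp; rewrite uniq_pairwise pairwise_map.
apply: (@sub_in_pairwise _ prime) rp => p q pp pq /= npq.
by rewrite coprimeXl// coprimeXr// prime_coprime// dvdn_prime2.
Qed.

Lemma prod_prime_pow_dvdn (e : nat -> nat) (a b m : nat) :
  (forall p, prime p -> (a <= p < b)%N -> (p ^ e p %| m)%N) ->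
  (\prod_(a <= p < b | prime p) p ^ e p %| m)%N.
Proof.
move=> h; apply/unstable.Gauss_dvd_prod => [|p]; last first.
  by rewrite mem_index_iota => pab pp; exact: h.
apply: pairwise_coprime_prime_pow; first exact: filter_all.
by rewrite filter_uniq// iota_uniq.
Qed.

Lemma prod_prime_dvdn (a b m : nat) :
  (forall p, prime p -> (a <= p < b)%N -> (p %| m)%N) ->
  (\prod_(a <= p < b | prime p) p %| m)%N.
Proof.
move=> h; rewrite (eq_bigr (fun p => p ^ 1)%N) => [|p _]; last by rewrite expn1.
by apply: prod_prime_pow_dvdn => p pp pab; rewrite expn1 h.
Qed.

(** The row of index 2m+1 has two equal middle coefficients, and its total is 2 * 4^m. *)
Lemma bin_odd_mid_le (m : nat) : ('C(m.*2.+1, m) <= 4 ^ m)%N.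
Proof.
have e : (2 ^ m.*2.+1 = \sum_(i < m.*2.+2) 'C(m.*2.+1, i))%N.
  by rewrite -[2%N]/(1 + 1)%N expnDn; apply: eq_bigr => i _; rewrite !exp1n !muln1.
have lm : (m < m.*2.+2)%N by lia.
have lm1 : (m.+1 < m.*2.+2)%N by lia.
have : ('C(m.*2.+1, m) + 'C(m.*2.+1, m.+1) <= 2 ^ m.*2.+1)%N.
  rewrite e (bigD1 (Ordinal lm))//= leq_add2l (bigD1 (Ordinal lm1))//= ?leq_addr//.
  by rewrite -val_eqE /=; lia.
have -> : 'C(m.*2.+1, m.+1) = 'C(m.*2.+1, m).
  by rewrite -bin_sub; [congr ('C(_, _)); lia | lia].
by rewrite -[4%N]/(2 ^ 2)%N -expnM mul2n addnn expnS -mul2n leq_pmul2l.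
Qed.

Lemma prime_dvdn_fact (p m : nat) : prime p -> (p %| m`!)%N -> (p <= m)%N.
Proof.
move=> pp; elim: m => [|m IH]; first by rewrite dvdn1 => /eqP p1; rewrite p1 in pp.
by rewrite factS Euclid_dvdM// => /orP[/dvdn_leq -> //|/IH /leqW].
Qed.

(** Such primes divide (2m+1)! but neither m! nor (m+1)!, hence they divide the binomial
    coefficient, and so does their product. *)
Lemma prod_prime_mid_le (m : nat) :
  (\prod_(m.+2 <= p < m.*2.+2 | prime p) p <= 4 ^ m)%N.
Proof.
apply: leq_trans (bin_odd_mid_le m); apply: dvdn_leq; first by rewrite bin_gt0; lia.
apply: prod_prime_dvdn => p pp /andP[mp pm].
have mm : (m <= m.*2.+1)%N by lia.
have : (p %| (m.*2.+1)`!)%N by rewrite dvdn_fact// prime_gt0.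
rewrite -(bin_fact mm) !Euclid_dvdM//.
by case/orP => // /orP[] /(prime_dvdn_fact pp); lia.
Qed.

(** Erdős' induction: an even number above 2 adds no prime, and for 2m+1 the product is split after
    m+1, giving 4^(m+1) * 4^m. *)
Lemma primorial_le (n : nat) : (\prod_(0 <= p < n.+1 | prime p) p <= 4 ^ n)%N.
Proof.
elim/ltn_ind: n => -[|[|[|n]]] IH.
- by rewrite big_mkcond big_nat1.
- by rewrite big_mkcond !big_nat_recr ?big_geq.
- by rewrite big_mkcond !big_nat_recr ?big_geq.
set N := n.+3; have [oN|eN] := boolP (odd N); last first.
  rewrite big_mkcond big_nat_recr//= -big_mkcond /= ifN ?muln1.
    by apply: leq_trans (IH n.+2 _) _ => //; rewrite leq_exp2l.
  by apply/negP => /even_prime; rewrite /N; case => //; move: eN; case: (odd _).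
pose m := N./2.
have eNm : N = m.*2.+1 by rewrite -[LHS]odd_double_half oN.
have m0 : (0 < m)%N by rewrite /N in eNm; lia.
rewrite eNm (big_cat_nat _ (n := m.+2)) //=; last lia.
apply: (@leq_trans (4 ^ m.+1 * 4 ^ m)%N); last by rewrite -expnD leq_exp2l//; lia.
by rewrite leq_mul// ?prod_prime_mid_le// IH//; lia.
Qed.

(** Only the first term of Legendre's formula for the exponent of p in n! is kept. *)
Lemma prod_prime_pow_divn_dvd_fact (n : nat) :
  (\prod_(0 <= p < n.+1 | prime p) p ^ (n %/ p) %| n`!)%N.
Proof.
apply: prod_prime_pow_dvdn => p pp /andP[_ pn].
rewrite pfactor_dvdn ?fact_gt0// logn_fact// big_ltn ?expn1 ?leq_addr//.
by have := prime_gt0 pp; lia.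
Qed.

(** * Mertens' estimates for sums over primes *)

Lemma ln_prod_nat (R : realType) (I : Type) (r : seq I) (P : pred I) (F : I -> nat) :
  (forall i, P i -> (0 < F i)%N) ->
  ln ((\prod_(i <- r | P i) F i)%N%:R : R) = \sum_(i <- r | P i) ln (F i)%:R.
Proof.
move=> F0; elim: r => [|i r IH]; first by rewrite !big_nil ln1.
rewrite !big_cons; case: ifP => // Pi.
by rewrite natrM lnM ?IH// posrE ltr0n ?F0// prodn_cond_gt0.
Qed.

Lemma fact_le_expn (n : nat) : (n`! <= n ^ n)%N.
Proof.
have -> : (n ^ n = \prod_(1 <= i < n.+1) n)%N by rewrite prod_nat_const_nat subn1.
rewrite fact_prod big_nat [leqRHS]big_nat.
by apply: leq_prod => i; lia.
Qed.

(** After multiplication by n, n / p is at most its integer part plus 1. The integer parts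
    contribute at most ln n! <= n ln n, the ones at most the logarithm of the primorial. *)
Lemma sum_ln_prime_div_le (R : realType) (n : nat) : (0 < n)%N ->
  \sum_(0 <= p < n.+1 | prime p) ln p%:R / p%:R <= ln n%:R + ln 4 :> R.
Proof.
move=> n0; have n0R : (0 : R) < n%:R by rewrite ltr0n.
have dvn p : (0 < p)%N -> n%:R / p%:R <= (n %/ p)%:R + 1 :> R.
  move=> p0; rewrite ler_pdivrMr ?ltr0n// natr1 -natrM ler_nat.
  by rewrite ltnW// ltn_ceil.
have lnX p k : prime p -> ln (p ^ k)%:R = ln p%:R *+ k :> R.
  by move=> pp; rewrite natrX lnXn// ltr0n prime_gt0.
rewrite -(ler_pM2l n0R) mulr_sumr.
apply: (@le_trans _ _ (\sum_(0 <= p < n.+1 | prime p) ((ln p%:R *+ (n %/ p)) + ln p%:R))).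
  apply: ler_sum => p pp; rewrite -mulr_natl.
  have := @ln_ge0 R p%:R; rewrite ler1n prime_gt0// => /(_ isT) l0.
  have := ler_wpM2r l0 (dvn p (prime_gt0 pp)).
  lra.
rewrite big_split/= mulrDr; apply: lerD.
  rewrite -(eq_bigr _ (fun p pp => lnX p (n %/ p)%N pp)) -ln_prod_nat => [|p pp]; last first.
    by rewrite expn_gt0 prime_gt0.
  rewrite mulr_natl -lnXn// -natrX ler_ln ?posrE ?ltr0n ?expn_gt0 ?n0//; last first.
    by rewrite prodn_cond_gt0// => p pp; rewrite expn_gt0 prime_gt0.
  rewrite ler_nat; apply: leq_trans (fact_le_expn n).
  by apply: dvdn_leq (prod_prime_pow_divn_dvd_fact n); rewrite fact_gt0.
rewrite -ln_prod_nat => [|p /prime_gt0//].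
rewrite mulr_natl -lnXn// -natrX ler_ln ?posrE ?ltr0n ?expn_gt0//.
  by rewrite ler_nat primorial_le.
by rewrite prodn_cond_gt0// => p /prime_gt0.
Qed.

Lemma big_prime_recr (R : nmodType) (n : nat) (F : nat -> R) :
  \sum_(0 <= p < n.+1 | prime p) F p =
  \sum_(0 <= p < n | prime p) F p + (if prime n then F n else 0).
Proof. by rewrite big_mkcond big_nat_recr//= -big_mkcond. Qed.

Lemma sum_prime_inv_le (R : realType) : exists C : R, forall n, (2 <= n)%N ->
  \sum_(0 <= p < n.+1 | prime p) p%:R^-1 <= ln (ln n%:R) + C.
Proof.
pose T n : R := \sum_(0 <= p < n.+1 | prime p) p%:R^-1.
pose S n : R := \sum_(0 <= p < n.+1 | prime p) ln p%:R / p%:R.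
pose L : R := ln 4.
have ln0 n : (2 <= n)%N -> 0 < ln n%:R :> R by move=> n2; rewrite ln_gt0// ltr1n.
(* With this [K], both sides of [U] vanish at n = 2. *)
pose K : R := L / ln 2 - ln (ln 2).
(* The left side is the Abel sum of S m (1 / ln m - 1 / ln (m + 1)) over 2 <= m < n. *)
have U n : (2 <= n)%N -> T n - S n / ln n%:R <= ln (ln n%:R) - L / ln n%:R + K.
  elim: n => // n IH; rewrite leq_eqVlt => /orP[/eqP [<-]|].
    rewrite /T /S !big_prime_recr !big_geq//= !add0r.
    have -> : ln 2 / 2 / ln 2 = 2^-1 :> R.
      by field; rewrite gt_eqF// ln0.
    by rewrite /K; lra.
  (* Abel summation, one step at a time: since [S n <= ln n + L], the increment is at most
     [1 - ln n / ln (n + 1) + L / ln n - L / ln (n + 1)], and [1 - t <= - ln t]. *)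
  rewrite ltnS => n2; have {}IH := IH n2.
  have l0 := ln0 _ n2; have l1 : 0 < ln n.+1%:R :> R by rewrite ln0// ltnW.
  have ll : ln n%:R <= ln n.+1%:R :> R by rewrite ler_ln ?posrE ?ltr0n ?ler_nat//; lia.
  have SL : S n <= ln n%:R + L by apply: sum_ln_prime_div_le; lia.
  have -> : T n.+1 - S n.+1 / ln n.+1%:R =
      T n - S n / ln n%:R + S n * ((ln n%:R)^-1 - (ln n.+1%:R)^-1).
    rewrite /T /S [X in X - _]big_prime_recr [X in _ - X / _]big_prime_recr.
    rewrite -/(T n) -/(S n); case: ifP => _; first field.
      by rewrite !gt_eqF//=.
    by field; rewrite !gt_eqF//=.
  have dl : 0 <= (ln n%:R)^-1 - (ln n.+1%:R)^-1 :> R.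
    by rewrite subr_ge0 lef_pV2.
  have := ler_wpM2r dl SL.
  have q0 : 0 < ln n%:R / ln n.+1%:R :> R by rewrite divr_gt0.
  have := @le_ln1Dx R (ln n%:R / ln n.+1%:R - 1).
  have -> : 1 + (ln n%:R / ln n.+1%:R - 1) = ln n%:R / ln n.+1%:R :> R by ring.
  rewrite ltrBrDl addrN q0 ln_div ?posrE// => /(_ isT) h.
  have -> : (ln n%:R + L) * ((ln n%:R)^-1 - (ln n.+1%:R)^-1) =
     1 - ln n%:R / ln n.+1%:R + L / ln n%:R - L / ln n.+1%:R :> R.
    by field; rewrite !gt_eqF//=.
  lra.
exists (K + 1) => n n2; rewrite -/(T n).
have l0 := ln0 _ n2.
have : S n / ln n%:R <= 1 + L / ln n%:R.
  rewrite ler_pdivrMr// mulrDl mul1r divfK ?gt_eqF//.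
  by apply: sum_ln_prime_div_le; lia.
by have := U _ n2; lra.
Qed.

(** The sum of 1 / (m (m - 1)) over all m from 2 to n telescopes to the right side. *)
Lemma sum_prime_inv_mul_pred_le (R : realType) (n : nat) : (0 < n)%N ->
  \sum_(0 <= p < n.+1 | prime p) (p%:R * (p%:R - 1))^-1 <= 1 - n%:R^-1 :> R.
Proof.
elim: n => // -[|n] IH _.
  by rewrite !big_prime_recr big_geq// !addr0 invr1 subrr.
rewrite big_prime_recr; have {}IH := IH isT.
have n0 : 0 < n.+1%:R :> R by rewrite ltr0n.
have n1 : 0 < n.+2%:R :> R by rewrite ltr0n.
have -> : 1 - n.+2%:R^-1 = 1 - n.+1%:R^-1 + (n.+2%:R * (n.+2%:R - 1))^-1 :> R.
  rewrite -[n.+2%:R]natr1 addrK; field.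
  by rewrite addrC natr1 !gt_eqF.
have p0 : 0 <= (n.+2%:R * (n.+2%:R - 1))^-1 :> R.
  by rewrite invr_ge0 mulr_ge0// subr_ge0 ler1n.
by rewrite lerD//; case: (prime n.+2).
Qed.

Lemma sum_prime_inv_pred_le (R : realType) : exists C : R, forall n, (2 <= n)%N ->
  \sum_(0 <= p < n.+1 | prime p) (p%:R - 1)^-1 <= ln (ln n%:R) + C.
Proof.
have [C hC] := sum_prime_inv_le R; exists (C + 1) => n n2.
rewrite (eq_bigr (fun p => p%:R^-1 + (p%:R * (p%:R - 1))^-1)) => [|p /prime_gt1 p1].
  rewrite big_split/= addrA lerD ?hC//.
  apply: le_trans (sum_prime_inv_mul_pred_le R (ltnW n2)) _.
  by rewrite gerBl invr_ge0.
by field; rewrite subr_eq0 pnatr_eq1 pnatr_eq0; lia.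
Qed.

(** * The product of b / (b - 1) over the first d primes *)

Lemma nth_primeP (j : nat) : prime (nth_prime j).
Proof. by case: j => //= j; case: ex_minnP => p /andP[]. Qed.

Lemma ltn_nth_primeS (j : nat) : (nth_prime j < nth_prime j.+1)%N.
Proof. by rewrite /=; case: ex_minnP => p /andP[]. Qed.

Lemma nth_prime_inj : injective nth_prime.
Proof.
have h i j : (i < j)%N -> nth_prime i != nth_prime j.
  by move=> ij; rewrite neq_ltn (homo_ltn ltn_trans ltn_nth_primeS).
move=> i j /eqP ij; case: (ltngtP i j) => // /h; last rewrite eq_sym; by rewrite ij.
Qed.

Lemma sum_nth_prime_le (R : numDomainType) (d n : nat) (g : nat -> R) :
  (forall p, prime p -> 0 <= g p) ->
  \sum_(j < d | (nth_prime j <= n)%N) g (nth_prime j) <=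
  \sum_(0 <= p < n.+1 | prime p) g p.
Proof.
move=> g0; set s := [seq nth_prime j | j <- iota 0 d & (nth_prime j <= n)%N].
have us : uniq s by rewrite (map_inj_uniq nth_prime_inj) filter_uniq// iota_uniq.
have -> : \sum_(j < d | (nth_prime j <= n)%N) g (nth_prime j) = \sum_(p <- s) g p.
  rewrite big_map big_filter.
  by rewrite -(big_mkord (fun j => nth_prime j <= n)%N (fun j => g (nth_prime j))) /index_iota subn0.
rewrite [leRHS](bigID (mem s))/= ler_wpDr//; first by apply: sumr_ge0 => p /andP[/g0].
rewrite -[leRHS]big_filter le_eqVlt; apply/orP; left; apply/eqP/perm_big/uniq_perm => //.
  by rewrite filter_uniq// iota_uniq.
move=> p; rewrite mem_filter mem_index_iota /=.
case: (boolP (p \in s)) => [|_]; last by rewrite andbF.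
case/mapP => j; rewrite mem_filter => /andP[jn _] ->.
by rewrite nth_primeP.
Qed.

(** Each factor is 1 + 1 / (b - 1) <= exp (1 / (b - 1)), so it suffices to bound the sum of 1 / (b -
    1) by ln (ln d) + C + 1. *)
Lemma prod_nth_prime_le (R : realType) : exists C : R, forall d, (2 <= d)%N ->
  \prod_(j < d) ((nth_prime j)%:R / ((nth_prime j)%:R - 1)) <= C * ln d%:R.
Proof.
have [C hC] := sum_prime_inv_pred_le R; exists (expR (C + 1)).
move=> d d2; have d0 : (0 : R) < d%:R by rewrite ltr0n ltnW.
have p1 p : prime p -> 0 < p%:R - 1 :> R by move/prime_gt1 => ?; rewrite subr_gt0 ltr1n.
have l0 : 0 < ln d%:R :> R by rewrite ln_gt0// ltr1n.
apply: (@le_trans _ _ (expR (\sum_(j < d) ((nth_prime j)%:R - 1)^-1))).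
  rewrite expR_sum; apply: ler_prod => j _; have := p1 _ (nth_primeP j) => b0.
  rewrite divr_ge0 ?(ltW b0)//=; apply: le_trans (expR_ge1Dx _).
  by rewrite le_eqVlt; apply/orP; left; apply/eqP; field; rewrite gt_eqF.
rewrite -[X in _ * X](lnK l0) -expRD ler_expR.
(* The d first primes include at most d primes above d, so these contribute at most 1. *)
rewrite (bigID (fun j : 'I_d => nth_prime j <= d)%N)/=.
rewrite [C + 1 + _]addrC addrA; apply: lerD.
  apply: le_trans (hC _ d2); apply: (@sum_nth_prime_le _ d d (fun p => (p%:R - 1)^-1)).
  by move=> p /p1 ?; rewrite invr_ge0 ltW.
apply: (@le_trans _ _ (\sum_(j < d) d%:R^-1)); last first.
  by rewrite sumr_const card_ord -[_^-1 *+ _]mulr_natl divff// gt_eqF.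
rewrite big_mkcond; apply: ler_sum => j _; case: ifP => [|_]; last by rewrite invr_ge0 ltW.
rewrite -ltnNge => dj; rewrite lef_pV2 ?posrE ?p1 ?nth_primeP//.
by rewrite lerBrDr natr1 ler_nat.
Qed.

(** * Cells of Halton points as residue classes *)

(* [rev_digits b m i] is the reversal of the [m] lowest base-[b] digits of [i];
   it equals [floor (b ^ m * a)] for [a] the radical inverse of [i]. *)
Fixpoint rev_digits (b m i : nat) : nat :=
  if m is m'.+1 then (rev_digits b m' i * b + digit b i m)%N else 0.

Lemma ltn_digit (b i l : nat) : (0 < b)%N -> (digit b i l < b)%N.
Proof. exact: ltn_pmod. Qed.

Lemma eqn_mulD_small (b x y c d : nat) : (c < b)%N -> (d < b)%N ->
  (x * b + c == y * b + d)%N = (x == y) && (c == d).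
Proof.
move=> cb db; apply/eqP/andP => [e|[/eqP-> /eqP->]//].
have b0 : (0 < b)%N by exact: leq_ltn_trans cb.
split; apply/eqP.
  by have := congr1 (divn^~ b) e; rewrite !divnMDl// !divn_small// !addn0.
by have := congr1 (modn^~ b) e; rewrite !modnMDl !modn_small.
Qed.

Lemma modn_expS (b m i : nat) : (0 < b)%N ->
  (i %% b ^ m.+1 = digit b i m.+1 * b ^ m + i %% b ^ m)%N.
Proof.
move=> b0; rewrite /digit /= modn_divl expnS [LHS](divn_eq _ (b ^ m)).
by rewrite modn_dvdm// dvdn_mull.
Qed.

Lemma eqn_rev_digits (b m i i' : nat) : (0 < b)%N ->
  (rev_digits b m i == rev_digits b m i') = (i == i' %[mod b ^ m])%N.
Proof.
move=> b0; elim: m => [|m IH]; first by rewrite expn0 !modn1 eqxx.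
rewrite !modn_expS//= !eqn_mulD_small ?ltn_digit ?ltn_pmod ?expn_gt0 ?b0//.
by rewrite IH andbC.
Qed.

Lemma rev_digits_div (b m t i : nat) : (0 < b)%N ->
  (rev_digits b (m + t) i %/ b ^ t = rev_digits b m i)%N.
Proof.
move=> b0; elim: t => [|t IH]; first by rewrite addn0 divn1.
by rewrite addnS /= expnS divnMA divnMDl// (divn_small (ltn_digit _ _ b0)) addn0.
Qed.

Lemma sum_digits (R : realType) (b N i : nat) : (0 < b)%N ->
  \sum_(1 <= l < N.+1) (digit b i l)%:R / b%:R ^+ l =
  (rev_digits b N i)%:R / b%:R ^+ N :> R.
Proof.
move=> b0; have b0R : b%:R != 0 :> R by rewrite pnatr_eq0 -lt0n.
elim: N => [|N IH]; first by rewrite big_geq// mul0r.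
rewrite big_nat_recr//= IH natrD natrM exprS; field.
by rewrite expf_neq0.
Qed.

(** Since i < b^i, all digits of i beyond the N-th vanish, so the series is a finite sum. *)
Lemma halton_rev_digits (R : realType) (i j N : nat) : (i <= N)%N ->
  halton R i j = (rev_digits (nth_prime j) N i)%:R / (nth_prime j)%:R ^+ N.
Proof.
move=> iN; set b := nth_prime j.
have b1 : (1 < b)%N := prime_gt1 (nth_primeP j).
rewrite -sum_digits; last exact: ltnW.
apply: lim_near_cst => //; exists N.+1 => // M /= NM.
rewrite (big_cat_nat _ (n := N.+1))//= [X in _ + X]big_nat [X in _ + X]big1 ?addr0// => l /andP[Nl _].
rewrite /digit divn_small ?mod0n ?mul0r//.
by apply: leq_ltn_trans (ltn_expl _ b1); rewrite (leq_trans iN)//; lia.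
Qed.

Lemma floor_exp_mul_halton (R : realType) (m i j : nat) :
  Num.floor ((nth_prime j)%:R ^+ m * halton R i j) =
  (rev_digits (nth_prime j) m i)%:Z.
Proof.
have b0 : (0 < nth_prime j)%N := prime_gt0 (nth_primeP j).
(* With m + i digits the point is represented exactly, and taking the floor cuts off the last i of
   them. *)
rewrite (@halton_rev_digits _ _ _ (m + i)) ?leq_addl//.
have b0R : 0 < (nth_prime j)%:R :> R by rewrite ltr0n.
have bX n : (nth_prime j)%:R ^+ n != 0 :> R by rewrite expf_neq0// gt_eqF.
rewrite exprD invfM mulrCA mulVKf//.
apply: floor_def; rewrite -(rev_digits_div m i i b0).
rewrite ler_pdivlMr ?exprn_gt0// ltr_pdivrMr ?exprn_gt0//.
rewrite -natrX -!natrM ler_nat leq_divM/= addn1 ltr_nat.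
by rewrite ltn_ceil// expn_gt0 b0.
Qed.

Lemma same_cell_halton (R : realType) (m i i' j : nat) :
  same_cell (nth_prime j) m (halton R i j) (halton R i' j) =
  (i == i' %[mod nth_prime j ^ m])%N.
Proof.
rewrite /same_cell !floor_exp_mul_halton eqz_nat eqn_rev_digits//.
exact: prime_gt0 (nth_primeP j).
Qed.

(** * Positive semidefinite kernels *)

(* Gram kernels with finitely many features, hence positive semidefinite; the explicit
   features make closure under products immediate, without the Schur product theorem. *)
Definition gram (R : realType) (K : nat -> nat -> R) : Prop :=
  exists s : seq (nat -> R), forall i i', K i i' = \sum_(f <- s) f i * f i'.

(** Each feature contributes the square of its sum. *)
Lemma gram_sum_ge0 (R : realType) (K : nat -> nat -> R) (n : nat) :
  gram K -> 0 <= \sum_(i < n) \sum_(i' < n) K i i'.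
Proof.
case=> s Ks; suff -> : \sum_(i < n) \sum_(i' < n) K i i' =
    \sum_(f <- s) (\sum_(i < n) f i) ^+ 2.
  by apply: sumr_ge0 => f _; exact: sqr_ge0.
under eq_bigr => i _ do under eq_bigr => i' _ do rewrite Ks.
under eq_bigr do rewrite exchange_big /=.
rewrite exchange_big; apply: eq_bigr => f _ /=.
rewrite expr2 mulr_suml; apply: eq_bigr => i _.
by rewrite mulr_sumr.
Qed.

Lemma eq_gram (R : realType) (K L : nat -> nat -> R) :
  (forall i i', K i i' = L i i') -> gram K -> gram L.
Proof. by move=> KL [s Ks]; exists s => i i'; rewrite -KL. Qed.

Lemma gram0 (R : realType) : gram (fun _ _ => 0 : R).
Proof. by exists [::] => i i'; rewrite big_nil. Qed.

Lemma gram1 (R : realType) : gram (fun _ _ => 1 : R).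
Proof. by exists [:: fun=> 1] => i i'; rewrite big_seq1 mulr1. Qed.

Lemma gramD (R : realType) (K L : nat -> nat -> R) :
  gram K -> gram L -> gram (fun i i' => K i i' + L i i').
Proof. by move=> [s Ks] [t Lt]; exists (s ++ t) => i i'; rewrite big_cat Ks Lt. Qed.

Lemma gramM (R : realType) (K L : nat -> nat -> R) :
  gram K -> gram L -> gram (fun i i' => K i i' * L i i').
Proof.
move=> [s Ks] [t Lt]; exists [seq (fun i => f i * g i) | f <- s, g <- t] => i i'.
rewrite big_allpairs_dep Ks Lt mulr_suml; apply: eq_bigr => f _.
by rewrite mulr_sumr; apply: eq_bigr => g _; rewrite mulrACA.
Qed.

Lemma gramZ (R : realType) (c : R) (K : nat -> nat -> R) :
  0 <= c -> gram K -> gram (fun i i' => c * K i i').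
Proof.
move=> c0 gK; apply: gramM gK.
by exists [:: fun=> Num.sqrt c] => i i'; rewrite big_seq1 -expr2 sqr_sqrtr.
Qed.

Lemma gram_prod (R : realType) (J : Type) (r : seq J) (K : J -> nat -> nat -> R) :
  (forall j, gram (K j)) -> gram (fun i i' => \prod_(j <- r) K j i i').
Proof.
move=> gK; elim: r => [|j r IH].
  by apply: eq_gram (gram1 R) => i i'; rewrite big_nil.
by apply: eq_gram (gramM (gK j) IH) => i i'; rewrite big_cons.
Qed.

(** These are the mixed terms. Adding an index j turns the mixed part E into (C_j + D_j) E + C_j
    prod D + D_j prod C, which preserves positivity. For an empty list the expression would be
    -1. *)
Lemma gram_prodD (R : realType) (J : Type) (r : seq J) (C D : J -> nat -> nat -> R) :
  (0 < size r)%N -> (forall j, gram (C j)) -> (forall j, gram (D j)) ->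
  gram (fun i i' => \prod_(j <- r) (C j i i' + D j i i') -
    \prod_(j <- r) C j i i' - \prod_(j <- r) D j i i').
Proof.
move=> r0 gC gD; case: r r0 => // j r _; elim: r j => [|j' r IH] j.
  by apply: eq_gram (gram0 R) => i i'; rewrite !big_seq1; ring.
have gCr := gram_prod (j' :: r) gC; have gDr := gram_prod (j' :: r) gD.
have := gramD (gramM (gramD (gC j) (gD j)) (IH j'))
  (gramD (gramM (gC j) gDr) (gramM (gD j) gCr)).
by apply: eq_gram => i i'; rewrite ![\prod_(_ <- j :: _) _]big_cons; ring.
Qed.

Lemma sum_indicator (R : pzRingType) (b c : nat) (F : nat -> R) : (c < b)%N ->
  \sum_(t <- iota 0 b) (c == t)%:R * F t = F c.
Proof.
move=> cb; rewrite (bigD1_seq c) ?iota_uniq ?mem_iota//= eqxx mul1r.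
by rewrite big1 ?addr0// => t /negbTE; rewrite eq_sym => ->; rewrite mul0r.
Qed.

Lemma gram_eq (R : realType) (b : nat) (f : nat -> nat) : (forall i, (f i < b)%N) ->
  gram (fun i i' => (f i == f i')%:R : R).
Proof.
move=> fb; exists [seq (fun i => (f i == t)%:R) | t <- iota 0 b] => i i'.
by rewrite big_map sum_indicator// eq_sym.
Qed.

Lemma gram_eq_centered (R : realType) (b : nat) (f : nat -> nat) :
  (forall i, (f i < b)%N) -> gram (fun i i' => b%:R * (f i == f i')%:R - 1 : R).
Proof.
move=> fb; have b0 : b%:R != 0 :> R.
  by rewrite pnatr_eq0 -lt0n (leq_ltn_trans _ (fb 0%N)).
suff : gram (fun i i' => (f i == f i')%:R - b%:R^-1 : R).
  move/(gramZ (ler0n R b)); apply: eq_gram => i i'.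
  by rewrite mulrBr mulfV.
(* The features are the indicators of the b values of [f], centred by their average over the
   values. *)
exists [seq (fun i => (f i == t)%:R - b%:R^-1) | t <- iota 0 b] => i i'.
rewrite big_map; under eq_bigr do rewrite mulrBl.
rewrite sumrB sum_indicator// -mulr_sumr sumrB.
under [X in _ * (X - _)]eq_bigr do rewrite -[_%:R]mulr1.
rewrite sum_indicator// big_const_seq count_predT size_iota iter_addr_0.
by rewrite -[_^-1 *+ b]mulr_natr mulVf// subrr mulr0 subr0 eq_sym.
Qed.

(** * Counting congruences, and the Chinese remainder theorem *)

Lemma sum_eqmod_le (n M r : nat) : (0 < M)%N ->
  (M * \sum_(i < n) (r == i %[mod M]) <= n + M)%N.
Proof.
(* The shift [c] makes (n + c) / M jump exactly when n passes a member of the class of r. *)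
move=> M0; pose c := (M - (r %% M).+1)%N.
have rM : (r %% M < M)%N by rewrite ltn_pmod.
suff -> : (\sum_(i < n) (r == i %[mod M]) = (n + c) %/ M)%N.
  by rewrite mulnC (leq_trans (leq_divM _ _))// leq_add2l /c leq_subr.
elim: n => [|n IH]; first by rewrite big_ord0 divn_small// /c; lia.
rewrite big_ord_recr/= IH addSn divnS// addnC; congr (_ + _)%N.
rewrite -(modn_mod r) -(eqn_modDr (c.+1)) (_ : (r %% M + c.+1 = M)%N); last by rewrite /c; lia.
by rewrite modnn addnS eq_sym.
Qed.

Lemma eqmod_prod (J : finType) (F : J -> nat) (i i' : nat) :
  {in predT &, forall j j', j != j' -> coprime (F j) (F j')} ->
  (i == i' %[mod \prod_j F j])%N = [forall j, i == i' %[mod F j]]%N.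
Proof.
move=> cF; wlog ii : i i' / (i <= i')%N => [h|].
  have [/h//|/ltnW /h e] := leqP i i'.
  by rewrite eq_sym e; apply: eq_forallb => j; rewrite eq_sym.
rewrite eq_sym eqn_mod_dvd//; apply/idP/forallP => [h j|h].
  rewrite eq_sym eqn_mod_dvd// (dvdn_trans _ h)//.
  by rewrite (bigD1 j)//= dvdn_mulr.
apply/unstable.Gauss_dvd_prod => [|j _ _]; last by rewrite -eqn_mod_dvd// eq_sym h.
rewrite filter_predT pairwise_map; have := index_enum_uniq J.
rewrite uniq_pairwise; apply: sub_pairwise => j j' /= jj.
exact: cF.
Qed.

(** * Bounds for the double sum in the gain coefficient *)

Section GainKernel.
Variables (R : realType) (J : finType) (b k : J -> nat) (n : nat).
Hypotheses (b_prime : forall j, prime (b j)) (b_inj : injective b).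

Let A j i i' : R := (i == i' %[mod b j ^ (k j).+1])%N%:R.
Let D j i i' : R := (i == i' %[mod b j ^ k j])%N%:R.
Let C j i i' : R := (b j)%:R * A j i i' - D j i i'.
Let b0 j : (0 < b j)%N := prime_gt0 (b_prime j).

Lemma gram_same_cell j : gram (D j).
Proof. by apply: (@gram_eq _ (b j ^ k j)) => i; rewrite ltn_pmod ?expn_gt0 ?b0. Qed.

(** Congruence mod b^(k+1) is congruence mod b^k plus equality of the next digit, so C_j is D_j
    times a centred equality kernel of that digit. *)
Lemma gram_gain_factor j : gram (C j).
Proof.
have dl i : (digit (b j) i (k j).+1 < b j)%N by exact: ltn_digit.
apply: eq_gram (gramM (gram_same_cell j) (gram_eq_centered R dl)) => i i'.
rewrite /C /A /D !modn_expS// eqn_mulD_small ?ltn_pmod ?expn_gt0 ?b0//.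
by case: eqP; case: eqP; rewrite /= ?mulr1 ?mulr0 ?mul0r ?mul1r ?subrr//.
Qed.

Lemma sum_gain_kernel_ge0 :
  0 <= \sum_(i < n) \sum_(i' < n) \prod_j C j i i'.
Proof. exact: (gram_sum_ge0 n (gram_prod (index_enum J) gram_gain_factor)). Qed.

Let coprime_exp (e : J -> nat) :
  {in predT &, forall j j', j != j' -> coprime (b j ^ e j) (b j' ^ e j')}.
Proof.
move=> j j' _ _ jj; rewrite coprimeXl// coprimeXr//.
by rewrite prime_coprime// dvdn_prime2// (inj_eq b_inj).
Qed.

Let prod_eqmod (e : J -> nat) i i' :
  \prod_j (i == i' %[mod b j ^ e j])%N%:R = (i == i' %[mod \prod_j b j ^ e j])%N%:R :> R.
Proof.
rewrite eqmod_prod//; case: forallP => [h|/forallP].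
  by rewrite big1// => j _; rewrite h.
by rewrite negb_forall => /existsP[j /negbTE h]; rewrite (bigD1 j)//= h mul0r.
Qed.

(* Put M = prod b_j^(k_j+1), K = prod b_j^k_j, B = M / K. By the Chinese remainder theorem
   prod (C_j + D_j) = B 1_M and prod D_j = 1_K. With N(m) the number of pairs of indices
   below n that are congruent mod m, the sum of prod C_j is at most B N(M) - N(K), where
   M N(M) <= n^2 + n M and K N(K) >= n^2. *)
Lemma sum_gain_kernel_le : (0 < #|J|)%N ->
  \sum_(i < n) \sum_(i' < n) \prod_j C j i i' <= n%:R * \prod_j (b j)%:R.
Proof.
move=> J0; set B : R := \prod_j (b j)%:R.
pose M := (\prod_j b j ^ (k j).+1)%N; pose K := (\prod_j b j ^ k j)%N.
have M0 : (0 < M)%N by apply: prodn_gt0 => j; rewrite expn_gt0 b0.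
have K0 : (0 < K)%N by apply: prodn_gt0 => j; rewrite expn_gt0 b0.
have MK : M%:R = B * K%:R :> R.
  rewrite /M /K /B !natr_prod -big_split; apply: eq_bigr => j _ /=.
  by rewrite expnS natrM.
have nJ : (0 < size (index_enum J))%N.
  by have [j _] := card_gt0P J0; have := mem_index_enum j; case: (index_enum J).
have /(@gram_sum_ge0 _ _ n) := gram_prodD nJ gram_gain_factor gram_same_cell.
under eq_bigr => i _ do under eq_bigr => i' _ do
  rewrite (eq_bigr (fun j => (b j)%:R * A j i i') (fun j _ => subrK _ _)) big_split
    !prod_eqmod /= -/B -/M -/K.
under eq_bigr do rewrite !sumrB -mulr_sumr.
rewrite !sumrB -mulr_sumr.
set sM := \sum_(i < n) \sum_(i' < n) (_ == _ %[mod M])%N%:R.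
set sK := \sum_(i < n) \sum_(i' < n) (_ == _ %[mod K])%N%:R.
set sC := \sum_(i < n) _ => h.
have hM : M%:R * sM <= n%:R * (n%:R + M%:R).
  rewrite /sM mulr_sumr; apply: (@le_trans _ _ (\sum_(i < n) (n%:R + M%:R))).
    by apply: ler_sum => i _; rewrite -natr_sum -natrM -natrD ler_nat sum_eqmod_le.
  by rewrite sumr_const card_ord [leRHS]mulr_natl.
(* This is Cauchy-Schwarz for the sizes of the K residue classes, obtained from positivity of the
   centred kernel. *)
have hK : n%:R * n%:R <= K%:R * sK.
  have kl i : (i %% K < K)%N by rewrite ltn_pmod.
  have /(@gram_sum_ge0 _ _ n) := gram_eq_centered R kl.
  under eq_bigr do rewrite sumrB -mulr_sumr sumr_const card_ord.
  by rewrite sumrB -mulr_sumr sumr_const card_ord subr_ge0 -[_ *+ n *+ n]mulr_natl.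
(* Once everything is multiplied by K, the n^2 terms of [hM] and [hK] cancel and n B K remains. *)
have K0R : 0 < K%:R :> R by rewrite ltr0n.
rewrite -(ler_pM2l K0R).
have h2 := mulr_ge0 (ltW K0R) h.
rewrite MK in hM.
nra.
Qed.

End GainKernel.

(** * Bounds for the gain coefficients and their maximum *)

Section GainBounds.
Variables (R : realType) (d : nat) (u : {set 'I_d}) (k : {j : 'I_d | j \in u} -> nat).
Variable n : nat.

Let J := {j : 'I_d | j \in u}.
Let b (j : J) := nth_prime (val j).

Let b_prime j : prime (b j). Proof. exact: nth_primeP. Qed.
Let b_inj : injective b. Proof. by move=> i j /nth_prime_inj/val_inj/val_inj. Qed.
Let b_pred_gt0 j : 0 < (b j)%:R - 1 :> R.
Proof. by rewrite subr_gt0 ltr1n prime_gt1. Qed.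

Lemma gainE : gain R k n =
  n%:R^-1 * (\prod_j ((b j)%:R - 1)^-1) *
  \sum_(i < n) \sum_(i' < n) \prod_j
    ((b j)%:R * (i == i' %[mod b j ^ (k j).+1])%N%:R - (i == i' %[mod b j ^ k j])%N%:R).
Proof.
congr (_ * _); apply: eq_bigr => i _; apply: eq_bigr => i' _; apply: eq_bigr => j _ /=.
by rewrite !same_cell_halton.
Qed.

Lemma gain_ge0 : 0 <= gain R k n.
Proof.
rewrite gainE mulr_ge0 ?sum_gain_kernel_ge0// mulr_ge0 ?invr_ge0//.
by apply: prodr_ge0 => j _; rewrite invr_ge0 ltW.
Qed.

Lemma gain_le : (0 < n)%N -> u != finset.set0 ->
  gain R k n <= \prod_(j < d) ((nth_prime j)%:R / ((nth_prime j)%:R - 1)).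
Proof.
move=> n0 /finset.set0Pn[j0 uj0].
have J0 : (0 < #|{: J}|)%N by apply/card_gt0P; exists (exist _ j0 uj0).
have f1 j : 1 <= (nth_prime j)%:R / ((nth_prime j)%:R - 1) :> R.
  have p1 : 0 < (nth_prime j)%:R - 1 :> R.
    by rewrite subr_gt0 ltr1n prime_gt1// nth_primeP.
  by rewrite ler_pdivlMr// mul1r gerBl.
have n0R : 0 < n%:R :> R by rewrite ltr0n.
apply: (@le_trans _ _ (\prod_(j : J) ((b j)%:R / ((b j)%:R - 1)))).
  rewrite gainE big_split/= [leRHS]mulrC.
  have P0 : 0 <= n%:R^-1 * \prod_j ((b j)%:R - 1)^-1 :> R.
    by rewrite mulr_ge0 ?invr_ge0// prodr_ge0// => j _; rewrite invr_ge0 ltW.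
  have /(ler_wpM2l P0) h := sum_gain_kernel_le R k n b_prime b_inj J0.
  apply: le_trans h _.
  by rewrite mulrACA mulVf ?mul1r// gt_eqF.
(* Factors outside [u] are at least 1, so the product may be extended to all d primes. *)
rewrite [leRHS](bigID (mem u))/=.
rewrite -(big_sub u (fun j : 'I_d => (nth_prime j)%:R / ((nth_prime j)%:R - 1))).
rewrite ler_peMr//; last by elim/big_ind: _ => // x y; exact: mulr_ege1.
by apply: prodr_ge0 => j _; rewrite (le_trans ler01).
Qed.

End GainBounds.

Lemma max_gain_le (R : realType) (d : nat) (B : R) :
  (forall (u : {set 'I_d}) (k : {j : 'I_d | j \in u} -> nat) n, (0 < n)%N ->
    u != finset.set0 -> gain R k n <= B) -> (max_gain R d <= B%:E)%E.
Proof.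
move=> hB; rewrite /max_gain; elim/big_ind: _ => [|x y xB yB|u u0].
- exact: leNye.
- by rewrite ge_max xB.
- apply: ge_ereal_sup => _ [k _ <-]; apply: ge_ereal_sup => _ [n n0 <-].
  by rewrite lee_fin hB.
Qed.

Lemma max_gain_ge (R : realType) (d : nat) (u : {set 'I_d})
    (k : {j : 'I_d | j \in u} -> nat) n : (0 < n)%N -> u != finset.set0 ->
  ((gain R k n)%:E <= max_gain R d)%E.
Proof.
move=> n0 u0; rewrite /max_gain (bigD1 u)//= le_max; apply/orP; left.
apply: (@le_trans _ _ (ereal_sup [set (gain R k n)%:E | n in [set n | (0 < n)%N]])).
  by apply: ereal_sup_ubound; exists n.
by apply: ereal_sup_ubound; exists k.
Qed.

(** The range starts at d = 2 because ln 1 = 0, while for d = 1 the gain with n = 1 is already 1. *)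
Lemma max_gain_bounds (R : realType) : exists C : R, forall d, (2 <= d)%N ->
  (0 <= max_gain R d <= (C * ln d%:R)%:E)%E.
Proof.
have [C hC] := prod_nth_prime_le R; exists C => d d2; apply/andP; split; last first.
  by apply: max_gain_le => u k n n0 u0; exact: le_trans (gain_le R k n0 u0) (hC _ d2).
(* One nonnegative gain coefficient, here for a singleton, k = 0 and n = 1, bounds the maximum below
   by 0. *)
pose j0 : 'I_d := Ordinal (ltnW d2).
have u0 : finset.set1 j0 != finset.set0 by apply/finset.set0Pn; exists j0; rewrite finset.set11.
apply: (le_trans _ (@max_gain_ge R d _ (fun=> 0%N) 1 isT u0)).
by rewrite lee_fin gain_ge0.
Qed.

Unset Implicit Arguments.

(* MathComp world. Finiteness makes [fine] lossless in the second conjunct. *)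
Theorem theorem4 (R : realType) :
  (\forall d \near \oo, max_gain R d \is a fin_num) /\
  (fun d : nat => fine (max_gain R d)) =O_\oo (fun d : nat => ln (d%:R : R)).
Proof.
have [C hC] := max_gain_bounds R.
have fin d : (2 <= d)%N -> max_gain R d \is a fin_num.
  move=> /hC /andP[h0 h1]; rewrite ge0_fin_numE//; exact: le_lt_trans h1 (ltry _).
split; first by exists 2.
(* The constant has to be positive, and the sign of [C] is not known. *)
apply/eqO_exP; exists (`|C| + 1); first by rewrite ltr_pwDr.
exists 2 => // d /= d2; have /andP[h0 h1] := hC _ d2.
have l0 : 0 <= ln d%:R :> R by rewrite ln_ge0// ler1n ltnW.
rewrite ger0_norm ?fine_ge0// (ger0_norm l0) -lee_fin fineK ?fin//.
apply: le_trans h1 _; rewrite lee_fin ler_wpM2r//.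
by rewrite (le_trans (ler_norm C))// lerDl.
Qed.
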